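(* Let $\lambda>1$ be a real number, let $N\ge 0$ be an integer, let $c_0,\dots,c_N$ be real numbers and let $d_0<d_1<\cdots<d_N$ be rational numbers. Then the refinement equation $$ f(x)=\sum_{j=0}^N c_j f(\lambda x-d_j),\qquad x\in\mathbf{R}, $$ has only the trivial compactly supported $\mathbf{C}^{\infty}$ solution; that is, if $f$ is a compactly supported $\mathbf{C}^\infty$ function on $\mathbf{R}$ satisfying this equation, then $f\equiv 0$.
   Context: The equation is called a refinement equation with dilation $\lambda$ and translations $d_j$. The dilation $\lambda>1$ is an arbitrary real number (not necessarily an integer). *)

(* Defs.v *)
From Stdlib Require Import Reals QArith Qreals.
From Coquelicot Require Import Coquelicot.
Open Scope R_scope.

(* Since [Derive] is total, differentiability of every iterated derivative has
   to be required explicitly; [ex_derive_n f 0 x] is [True], and the continuity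
   of all derivatives follows from the differentiability at the next order. *)
Definition smooth (f : R -> R) : Prop :=
  forall (n : nat) (x : R), ex_derive_n f n x.

Definition support (f : R -> R) : R -> Prop :=
  adherence (fun x => f x <> 0).

Definition compactly_supported (f : R -> R) : Prop :=
  compact (support f).

(* [sum_f_R0 u N] has the N + 1 terms u 0, ..., u N; the values of [c] and [d]
   beyond index [N] are irrelevant. *)
Definition refinement_equation
    (lambda : R) (N : nat) (c : nat -> R) (d : nat -> Q) (f : R -> R) : Prop :=
  forall x : R,
    f x = sum_f_R0 (fun j => c j * f (lambda * x - Q2R (d j))) N.

(* Main.v *)
(* The Fourier transform F of f satisfies |F(lambda xi)| = |P(xi)| |F(xi)| / lambda,
   where P is the symbol, the exponential sum with coefficients c_j and frequencies
   d_j; hence |F(lambda^n xi)| is lambda^(-n) |F(xi)| times the product of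
   |P(lambda^k xi)| over k < n.  As f is smooth, F decays faster than any power, so
   it suffices to find, in an interval where F does not vanish, points xi with
   |P(lambda^k xi)| >= delta for all k < n, with delta independent of n: then
   |F(lambda^n xi)| decays at most geometrically in n, with a fixed ratio.
   Because the d_j are rational, |P(xi)| is bounded below by |T(cos(xi / q))| for
   a nonzero real polynomial T (Chebyshev), hence by a constant at every point that
   stays away from finitely many arithmetic progressions.  The points xi are found by
   nested intervals: passing to a subinterval shorter by the factor lambda^r, with r
   large, leaves room to avoid all progressions at r consecutive levels. *)

Require Import Defs.
From Stdlib Require Import Reals QArith Qreals.
From Coquelicot Require Import Coquelicot.
From Stdlib Require Import Lra Lia List Classical ZArith.
Open Scope R_scope.

(** * Cosine polynomials *)

(* Horner form: [a] is the coefficient of [x ^ n], and it may vanish. *)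
Fixpoint polynomial (n : nat) (a : R) (f : R -> R) : Prop :=
  match n with
  | O => forall x, f x = a
  | S m => exists b g, polynomial m a g /\ forall x, f x = b + x * g x
  end.

Lemma polynomial_plus (n : nat) (a b : R) (f g : R -> R) :
  polynomial n a f -> polynomial n b g -> polynomial n (a + b) (fun x => f x + g x).
Proof.
  revert f g. induction n as [|n IH]; intros f g; simpl.
  - intros H1 H2 x. now rewrite H1, H2.
  - intros [b1 [g1 [H1 E1]]] [b2 [g2 [H2 E2]]].
    exists (b1 + b2), (fun x => g1 x + g2 x). split; [now apply IH|].
    intros x. rewrite E1, E2. ring.
Qed.

Lemma polynomial_scal (n : nat) (a k : R) (f : R -> R) :
  polynomial n a f -> polynomial n (k * a) (fun x => k * f x).
Proof.
  revert f. induction n as [|n IH]; intros f; simpl.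
  - intros H x. now rewrite H.
  - intros [b [g [H E]]]. exists (k * b), (fun x => k * g x). split; [now apply IH|].
    intros x. rewrite E. ring.
Qed.

Lemma polynomial_mult_X (n : nat) (a : R) (f : R -> R) :
  polynomial n a f -> polynomial (S n) a (fun x => x * f x).
Proof.
  intros H. exists 0, f. split; [exact H|]. intros x. ring.
Qed.

(** Padding with zero coefficients lets a lower-degree term be added without disturbing the leading
    coefficient of the other summand. *)
Lemma polynomial_raise (n m : nat) (a : R) (f : R -> R) :
  (n < m)%nat -> polynomial n a f -> polynomial m 0 f.
Proof.
  revert m f. induction n as [|n IH]; intros m f Hm.
  - intros H. destruct m as [|m]; [lia|]. clear Hm. exists a, (fun _ => 0). split.
    + induction m as [|m IHm]; simpl; [reflexivity|].
      exists 0, (fun _ => 0). split; [exact IHm|]. intros; ring.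
    + intros x. rewrite H. ring.
  - destruct m as [|m]; [lia|]. intros [b [g [H E]]].
    exists b, g. split; [apply IH; [lia|exact H]|exact E].
Qed.

(** Synthetic division: if [f x = b + x * g x] and [g x = g r + (x - r) * k x], then [x * g x - r *
    g r = (x - r) * (g r + x * k x)]. The leading coefficient survives, so division can be
    repeated. *)
Lemma polynomial_factor (n : nat) (a r : R) (f : R -> R) :
  polynomial (S n) a f ->
  exists g, polynomial n a g /\ forall x, f x = f r + (x - r) * g x.
Proof.
  revert f. induction n as [|n IH]; intros f [b [g [H E]]].
  - exists g. split; [exact H|]. simpl in H. intros x. rewrite !E, !H. ring.
  - destruct (IH g H) as [k [Hk Ek]].
    exists (fun x => g r + x * k x). split.
    + exists (g r), k. split; [exact Hk|reflexivity].
    + intros x. rewrite (E x), (E r), (Ek x). ring.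
Qed.

Lemma polynomial_continuous (n : nat) (a : R) (f : R -> R) :
  polynomial n a f -> continuity f.
Proof.
  revert f. induction n as [|n IH]; intros f.
  - intros H x. apply continuity_pt_ext with (fun _ => a).
    + intros y. now rewrite H.
    + apply continuity_pt_const. now intros ? ?.
  - intros [b [g [H E]]] x. apply continuity_pt_ext with (fun y => b + y * g y).
    + intros y. now rewrite E.
    + apply (continuity_pt_plus (fun _ => b) (fun y => y * g y)).
      * apply continuity_pt_const. now intros ? ?.
      * apply (continuity_pt_mult id g); [apply continuity_pt_id|now apply IH].
Qed.

(** The recurrence [cos ((m+2) t) = 2 cos t cos ((m+1) t) - cos (m t)] needs two consecutive
    indices, so the induction carries both. Only the sign of the leading coefficient is recorded. *)
Lemma chebyshev (n : nat) :
  exists a T, 0 < a /\ polynomial n a T /\ forall t, T (cos t) = cos (INR n * t).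
Proof.
  assert (H : forall m,
    (exists a T, 0 < a /\ polynomial m a T /\ forall t, T (cos t) = cos (INR m * t)) /\
    (exists a T, 0 < a /\ polynomial (S m) a T /\ forall t, T (cos t) = cos (INR (S m) * t))).
  { induction m as [|m [IH1 IH2]].
    - split.
      + exists 1, (fun _ => 1). simpl. repeat split; try lra.
        intros t. now rewrite Rmult_0_l, cos_0.
      + exists 1, (fun x => x). repeat split; try lra.
        * exists 0, (fun _ => 1). split; [now simpl|]. intros; ring.
        * intros t. simpl. now rewrite Rmult_1_l.
    - split; [exact IH2|].
      destruct IH1 as [a [T [Ha [HT ET]]]], IH2 as [b [U [Hb [HU EU]]]].
      exists (2 * b + -1 * 0), (fun x => 2 * (x * U x) + -1 * T x). split; [lra|]. split.
      + apply polynomial_plus.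
        * apply polynomial_scal, polynomial_mult_X, HU.
        * apply polynomial_scal. apply polynomial_raise with m a; [lia|exact HT].
      + intros t. rewrite ET, EU, !S_INR.
        replace ((INR m + 1 + 1) * t) with ((INR m + 1) * t + t) by ring.
        replace (INR m * t) with ((INR m + 1) * t - t) by ring.
        rewrite cos_plus, cos_minus. ring. }
  apply H.
Qed.

(* Only the real roots matter: what remains after dividing them out has no zero
   on the compact interval [-1, 1]. *)
Lemma polynomial_cos_lower_bound (n : nat) (a : R) (f : R -> R) :
  a <> 0 -> polynomial n a f ->
  exists l : list R, forall s, 0 < s ->
    exists e, 0 < e /\ forall t,
      (forall b, In b l -> s <= Rabs (sin (t / 2 - b))) -> e <= Rabs (f (cos t)).
Proof.
  intros Ha. revert f. induction n as [n IH] using lt_wf_ind. intros f Hf.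
  destruct (classic (exists r, f r = 0)) as [[r Hr]|Hr].
  - destruct n as [|n]; [exfalso; simpl in Hf; rewrite Hf in Hr; now apply Ha|].
    destruct (polynomial_factor n a r f Hf) as [g [Hg E]].
    destruct (IH n ltac:(lia) g Hg) as [l Hl].
    destruct (Rle_or_lt (Rabs r) 1) as [H1|H1].
    + apply Rabs_le_between in H1.
      (* With [r = cos (acos r)], the factor [cos t - r] is [-2] times two sines of half angles;
         each is at least [s] in absolute value, which gives [2 * s * s]. *)
      exists (acos r / 2 :: - acos r / 2 :: l). intros s Hs.
      destruct (Hl s Hs) as [e [He Hle]].
      exists (2 * s * s * e). split; [repeat apply Rmult_lt_0_compat; lra|].
      intros t Ht. rewrite E, Hr, Rplus_0_l, Rabs_mult.
      assert (E1 : cos t - r = -2 * sin (t / 2 - acos r / 2) * sin (t / 2 - - acos r / 2)).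
      { rewrite <- (cos_acos r) at 1 by lra. rewrite form2.
        replace ((t - acos r) / 2) with (t / 2 - acos r / 2) by field.
        replace ((t + acos r) / 2) with (t / 2 - - acos r / 2) by field. reflexivity. }
      apply Rmult_le_compat.
      * repeat apply Rmult_le_pos; lra.
      * lra.
      * rewrite E1, !Rabs_mult, (Rabs_left (-2)) by lra.
        replace (2 * s * s) with (- (-2) * s * s) by ring.
        apply Rmult_le_compat; [lra|lra| |].
        -- apply Rmult_le_compat_l; [lra|]. apply Ht; simpl; tauto.
        -- apply Ht; simpl; tauto.
      * apply Hle. intros b Hb. apply Ht. simpl; tauto.
    (* A root outside [-1, 1] adds no zeros: its factor is at least [Rabs r - 1] in absolute value
       at every cosine. *)
    + exists l. intros s Hs. destruct (Hl s Hs) as [e [He Hle]].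
      exists ((Rabs r - 1) * e). split; [apply Rmult_lt_0_compat; lra|].
      intros t Ht. rewrite E, Hr, Rplus_0_l, Rabs_mult.
      apply Rmult_le_compat; [lra|lra| |now apply Hle].
      pose proof (COS_bound t). unfold Rabs in *.
      destruct (Rcase_abs r), (Rcase_abs (cos t - r)); lra.
  - exists nil. intros s Hs.
    destruct (continuity_ab_min (fun x => Rabs (f x)) (-1) 1) as [m [Hm _]].
    + lra.
    + intros x _. apply (continuity_pt_comp f Rabs).
      * now apply (polynomial_continuous n a).
      * apply Rcontinuity_abs.
    + exists (Rabs (f m)). split.
      * apply Rabs_pos_lt. intros H0. apply Hr. now exists m.
      * intros t _. apply Hm. apply COS_bound.
Qed.

Lemma sin_lower_bound (t : R) :
  0 < t -> exists s, 0 < s /\ forall y,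
    (forall n : Z, t <= Rabs (y - IZR n * PI)) -> s <= Rabs (sin y).
Proof.
  intros Ht. pose proof PI_RGT_0 as Hpi.
  (* Capping at [PI / 2] keeps [t'] in the range where sine increases; beyond [PI / 2] the
     reflection at [PI / 2] is used. *)
  pose (t' := Rmin t (PI / 2)).
  assert (Ht' : 0 < t' <= PI / 2).
  { unfold t'. split; [apply Rmin_glb_lt; lra|apply Rmin_r]. }
  exists (sin t'). split; [apply sin_gt_0; lra|].
  intros y Hy.
  assert (exists n : Z, 0 <= y - IZR n * PI < PI) as [n [Hn1 Hn2]].
  { exists (up (y / PI) - 1)%Z. rewrite minus_IZR.
    destruct (archimed (y / PI)) as [H1 H2].
    assert (Ey : y = y / PI * PI) by (field; lra).
    split; rewrite Ey at 1; nra. }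
  assert (Es : Rabs (sin y) = sin (y - IZR n * PI)).
  { set (z := y - IZR n * PI) in *.
    replace y with (z + IZR n * PI) by (unfold z; ring).
    rewrite sin_plus, (sin_eq_0_1 (IZR n * PI)) by now exists n.
    assert (Hz : 0 <= sin z) by (apply sin_ge_0; lra).
    (* The cosine of a multiple of [PI] is 1 or -1, so reduction modulo [PI] changes the sine only
       in sign. *)
    pose proof (sin2_cos2 (IZR n * PI)) as H2.
    rewrite (sin_eq_0_1 (IZR n * PI)) in H2 by now exists n.
    unfold Rsqr in H2.
    assert (H3 : (cos (IZR n * PI) - 1) * (cos (IZR n * PI) + 1) = 0) by nra.
    apply Rmult_integral in H3. destruct H3 as [H3|H3].
    - replace (cos (IZR n * PI)) with 1 by lra. rewrite Rabs_pos_eq; nra.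
    - replace (cos (IZR n * PI)) with (-1) by lra. rewrite Rabs_left1; nra. }
  rewrite Es. set (z := y - IZR n * PI) in *.
  assert (H1 : t' <= z).
  { specialize (Hy n). fold z in Hy. rewrite Rabs_pos_eq in Hy by lra.
    unfold t'. pose proof (Rmin_l t (PI / 2)). lra. }
  assert (H2 : z <= PI - t').
  { specialize (Hy (n + 1)%Z). rewrite plus_IZR in Hy.
    replace (y - (IZR n + 1) * PI) with (z - PI) in Hy by (unfold z; ring).
    rewrite Rabs_left in Hy by lra. unfold t'. pose proof (Rmin_l t (PI / 2)). lra. }
  destruct (Rle_or_lt z (PI / 2)).
  - apply sin_incr_1; lra.
  - rewrite <- (sin_PI_x z). apply sin_incr_1; lra.
Qed.

(** * Avoiding arithmetic progressions at all scales *)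

Lemma progression_in_interval (p z a b : R) :
  0 < p -> a <= b ->
  exists L : list R, INR (length L) <= (b - a) / p + 2 /\
    forall n : Z, a <= z + IZR n * p <= b -> In (z + IZR n * p) L.
Proof.
  intros Hp Hab.
  (* [m] is the floor of [(a - z) / p], and [K] exceeds [(b - a) / p + 1], so the [K] terms from
     index [m] on cover the interval; some of them may lie outside it. *)
  pose (m := (up ((a - z) / p) - 1)%Z).
  destruct (archimed ((a - z) / p)) as [Hm1 Hm2].
  pose (K := Z.to_nat (up ((b - a) / p + 1))).
  assert (Hq : 0 <= (b - a) / p) by (apply Rdiv_le_0_compat; lra).
  destruct (archimed ((b - a) / p + 1)) as [HK1 HK2].
  assert (HKZ : (0 <= up ((b - a) / p + 1))%Z) by (apply le_IZR; lra).
  exists (map (fun k => z + IZR (m + Z.of_nat k) * p) (seq 0 K)). split.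
  - rewrite length_map, length_seq. unfold K. rewrite INR_IZR_INZ, Z2Nat.id by exact HKZ. lra.
  - intros n [Hn1 Hn2]. apply in_map_iff. exists (Z.to_nat (n - m)).
    assert (Hx : (a - z) / p <= IZR n).
    { apply Rmult_le_reg_r with p; [lra|]. unfold Rdiv. rewrite Rmult_assoc, Rinv_l; lra. }
    assert (Hy : IZR n <= (b - z) / p).
    { apply Rmult_le_reg_r with p; [lra|]. unfold Rdiv. rewrite Rmult_assoc, Rinv_l; lra. }
    assert (Hmn : (m <= n)%Z).
    { unfold m. apply Z.lt_succ_r. apply lt_IZR. unfold Z.succ.
      rewrite plus_IZR, minus_IZR. lra. }
    split.
    + rewrite Z2Nat.id by lia. now replace (m + (n - m))%Z with n by lia.
    + apply in_seq. split; [lia|]. unfold K. simpl.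
      apply Z2Nat.inj_lt; [lia|lia|]. apply lt_IZR.
      assert ((b - z) / p = (b - a) / p + (a - z) / p) by (field; lra).
      unfold m. rewrite !minus_IZR. lra.
Qed.

(** Greedy search: if some [z] of [L] obstructs the candidate [u], move on by [3 * w]. Then [z] is
    at least [w] to the left of every later candidate, so it can be removed from the list. *)
Lemma avoid_points (w u : R) (L : list R) :
  0 < w ->
  exists v, u <= v <= u + 3 * w * INR (length L) /\
    forall z, In z L -> z <= v - w \/ v + 2 * w <= z.
Proof.
  intros Hw. remember (length L) as m eqn:Em. revert u L Em.
  induction m as [|m IH]; intros u L Em.
  - exists u. simpl. split; [lra|]. destruct L; [intros ? []|discriminate].
  - destruct (classic (forall z, In z L -> z <= u - w \/ u + 2 * w <= z)) as [H|H].
    + exists u. split; [|exact H]. pose proof (pos_INR (S m)). nra.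
    + apply not_all_ex_not in H. destruct H as [z Hz].
      apply imply_to_and in Hz. destruct Hz as [Hin Hz].
      destruct (in_split _ _ Hin) as [L1 [L2 EL]].
      destruct (IH (u + 3 * w) (L1 ++ L2)) as [v [Hv Hv2]].
      { rewrite EL, length_app in Em. simpl in Em. rewrite length_app. lia. }
      exists v. rewrite S_INR. split; [lra|].
      intros y Hy. rewrite EL in Hy. apply in_app_or in Hy. simpl in Hy.
      destruct Hy as [Hy|[Hy|Hy]].
      * apply Hv2, in_or_app; tauto.
      * subst y. left. apply Decidable.not_or in Hz. lra.
      * apply Hv2, in_or_app; tauto.
Qed.

(** At level [i] the zeros for one [b] form a progression of step [PI / (theta * lambda ^ i)], of
    which an interval of length [3 * h] meets at most [3 * h * theta / PI * lambda ^ i + 2] terms.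
    Summing over the levels gives a geometric sum. *)
Lemma bad_points (theta lambda h u : R) (l : list R) (r : nat) :
  0 < theta -> 1 < lambda -> 0 < h ->
  exists L : list R,
    INR (length L) <= INR (length l) *
      (3 * h * theta / PI * ((lambda ^ r - 1) / (lambda - 1)) + 2 * INR r) /\
    forall (i : nat) (b : R) (n : Z), (i < r)%nat -> In b l ->
      u - h <= (b + IZR n * PI) / (theta * lambda ^ i) <= u + 2 * h ->
      In ((b + IZR n * PI) / (theta * lambda ^ i)) L.
Proof.
  intros Ht Hl Hh. pose proof PI_RGT_0 as Hpi.
  assert (level : forall i, exists L : list R,
    INR (length L) <= INR (length l) * (3 * h * theta / PI * lambda ^ i + 2) /\
    forall b n, In b l ->
      u - h <= (b + IZR n * PI) / (theta * lambda ^ i) <= u + 2 * h ->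
      In ((b + IZR n * PI) / (theta * lambda ^ i)) L).
  { intros i. assert (Hli : 0 < lambda ^ i) by (apply pow_lt; lra).
    assert (Htl : 0 < theta * lambda ^ i) by (apply Rmult_lt_0_compat; lra).
    induction l as [|b l IH].
    - exists nil. simpl. split; [lra|]. intros b n [].
    - destruct IH as [L [HL1 HL2]].
      destruct (progression_in_interval (PI / (theta * lambda ^ i)) (b / (theta * lambda ^ i))
                  (u - h) (u + 2 * h)) as [M [HM1 HM2]].
      { apply Rdiv_lt_0_compat; lra. }
      { lra. }
      exists (M ++ L). split.
      + rewrite length_app, plus_INR. simpl length. rewrite S_INR.
        replace ((u + 2 * h - (u - h)) / (PI / (theta * lambda ^ i)))
          with (3 * h * theta / PI * lambda ^ i) in HM1 by (field; lra). lra.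
      + intros b' n [Hb|Hb] Hn; apply in_or_app.
        * subst b'. left. specialize (HM2 n).
          replace (b / (theta * lambda ^ i) + IZR n * (PI / (theta * lambda ^ i)))
            with ((b + IZR n * PI) / (theta * lambda ^ i)) in HM2 by (field; lra). now apply HM2.
        * right. now apply HL2. }
  induction r as [|r [L [HL1 HL2]]].
  - exists nil. split; [|intros; lia].
    simpl. pose proof (pos_INR (length l)). unfold Rdiv. rewrite Rminus_diag. nra.
  - destruct (level r) as [M [HM1 HM2]].
    exists (M ++ L). split.
    + rewrite length_app, plus_INR, S_INR.
      replace ((lambda ^ S r - 1) / (lambda - 1))
        with (lambda ^ r + (lambda ^ r - 1) / (lambda - 1)) by (simpl; field; lra).
      lra.
    + intros i b n Hi Hb Hn. apply in_or_app.
      destruct (Nat.eq_dec i r) as [E|E].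
      * subst i. left. now apply HM2.
      * right. apply HL2; trivial. lia.
Qed.

(** Bernoulli's inequality for [sqrt lambda], squared, gives quadratic growth in [r]. *)
Lemma pow_dominates_linear (lambda K : R) :
  1 < lambda -> exists r : nat, (0 < r)%nat /\ K * (INR r + 1) <= lambda ^ r.
Proof.
  intros Hl.
  pose (h := sqrt lambda - 1).
  assert (Hh : 0 < h).
  { unfold h. rewrite <- sqrt_1 at 1. pose proof (sqrt_lt_1 1 lambda). lra. }
  destruct (INR_unbounded (Rabs K / (h * h) + Rabs K / h)) as [r Hr].
  assert (H1 : 0 <= Rabs K / (h * h)) by (apply Rdiv_le_0_compat; [apply Rabs_pos|nra]).
  assert (H2 : 0 <= Rabs K / h) by (apply Rdiv_le_0_compat; [apply Rabs_pos|nra]).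
  exists r. split.
  { apply INR_lt. simpl. lra. }
  assert (Hb : 1 + INR r * h <= (1 + h) ^ r) by (apply poly; exact Hh).
  replace (1 + h) with (sqrt lambda) in Hb by (unfold h; ring).
  assert (El : lambda ^ r = sqrt lambda ^ r * sqrt lambda ^ r).
  { rewrite <- Rpow_mult_distr, sqrt_sqrt by lra. reflexivity. }
  rewrite El.
  assert (A1 : Rabs K <= INR r * (h * h)).
  { replace (Rabs K) with (Rabs K / (h * h) * (h * h)) by (field; lra).
    apply Rmult_le_compat_r; nra. }
  assert (A2 : Rabs K <= INR r * h).
  { replace (Rabs K) with (Rabs K / h * h) by (field; lra).
    apply Rmult_le_compat_r; nra. }
  pose proof (Rle_abs K). pose proof (pos_INR r).
  apply Rle_trans with ((1 + INR r * h) * (1 + INR r * h)); [|apply Rmult_le_compat; nra].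
  apply Rle_trans with (Rabs K * (INR r + 1)); [nra|].
  assert (Rabs K * INR r <= INR r * (h * h) * INR r) by (apply Rmult_le_compat_r; lra).
  nra.
Qed.

(* The zeros at the [r] levels meeting an interval of length [h] number at most
   [lambda ^ r / 6 + O(r)] once [h] is small, so one of [lambda ^ r / 3] disjoint
   candidate intervals of length [3 h / lambda ^ r] contains none of them. *)
Lemma good_subinterval (theta lambda hmax : R) (l : list R) :
  0 < theta -> 1 < lambda -> 0 < hmax ->
  exists h r s, 0 < h <= hmax /\ (0 < r)%nat /\ 0 < s /\
    forall u, exists v, u <= v /\ v + h / lambda ^ r <= u + h /\
      forall x i b, v <= x <= v + h / lambda ^ r -> (i < r)%nat -> In b l ->
        s <= Rabs (sin (theta * (lambda ^ i * x) - b)).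
Proof.
  intros Ht Hl Hm. pose proof PI_RGT_0 as Hpi.
  pose (D := INR (length l)). assert (HD : 0 <= D) by apply pos_INR.
  (* The constant 18 makes three times the geometric part of the count in [bad_points] at most half
     of [lambda ^ r - 1]. *)
  pose (h := Rmin hmax (PI * (lambda - 1) / (18 * theta * (D + 1)))).
  assert (Hden : 0 < 18 * theta * (D + 1)) by nra.
  assert (Hh : 0 < h).
  { apply Rmin_glb_lt; [lra|]. apply Rdiv_lt_0_compat; nra. }
  assert (Hh2 : 3 * D * (3 * h * theta / PI * / (lambda - 1)) <= / 2).
  { assert (A : h <= PI * (lambda - 1) / (18 * theta * (D + 1))) by apply Rmin_r.
    replace (3 * D * (3 * h * theta / PI * / (lambda - 1)))
      with (9 * D * theta / (PI * (lambda - 1)) * h) by (field; lra).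
    apply Rle_trans with
      (9 * D * theta / (PI * (lambda - 1)) * (PI * (lambda - 1) / (18 * theta * (D + 1)))).
    - apply Rmult_le_compat_l; [|exact A]. apply Rdiv_le_0_compat; nra.
    - replace (9 * D * theta / (PI * (lambda - 1)) * (PI * (lambda - 1) / (18 * theta * (D + 1))))
        with (/ 2 * (D / (D + 1))) by (field; repeat split; lra).
      assert (D / (D + 1) <= 1) by (apply Rle_div_l; lra). lra. }
  (* The remaining terms [6 * D * r + 3] are absorbed by the other half of [lambda ^ r]. *)
  destruct (pow_dominates_linear lambda (2 * (6 * D + 3)) Hl) as [r [Hr0 Hr]].
  pose (w := h / lambda ^ r).
  assert (Hlr : 0 < lambda ^ r) by (apply pow_lt; lra).
  assert (Hw : 0 < w) by (apply Rdiv_lt_0_compat; lra).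
  assert (Hl1 : 1 <= lambda ^ r) by (apply pow_R1_Rle; lra).
  assert (Hwl : w * lambda ^ r = h) by (unfold w; field; lra).
  assert (Hwh : w <= h) by nra.
  destruct (sin_lower_bound (theta * w)) as [s [Hs Hsin]]; [nra|].
  exists h, r, s. split; [split; [exact Hh|apply Rmin_l]|]. split; [exact Hr0|]. split; [exact Hs|].
  intros u. fold w.
  destruct (bad_points theta lambda h u l r Ht Hl Hh) as [L [HL1 HL2]].
  destruct (avoid_points w u L Hw) as [v [Hv1 Hv2]].
  fold D in HL1. pose proof (pos_INR r) as Hrp.
  assert (HL3 : 3 * (INR (length L) + 1) <= lambda ^ r).
  { assert (D * (3 * h * theta / PI * ((lambda ^ r - 1) / (lambda - 1)))
      = D * (3 * h * theta / PI * / (lambda - 1)) * (lambda ^ r - 1)) by (field; lra).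
    assert (3 * D * (3 * h * theta / PI * / (lambda - 1)) * (lambda ^ r - 1)
      <= / 2 * (lambda ^ r - 1)) by (apply Rmult_le_compat_r; lra).
    nra. }
  exists v. split; [lra|]. split.
  { assert (3 * w * (INR (length L) + 1) <= h) by nra. nra. }
  intros x i b Hx Hi Hb. apply Hsin. intros n.
  assert (Hli : 1 <= lambda ^ i) by (apply pow_R1_Rle; lra).
  pose (z := (b + IZR n * PI) / (theta * lambda ^ i)).
  assert (Ez : theta * (lambda ^ i * x) - b - IZR n * PI = theta * lambda ^ i * (x - z)).
  { unfold z. field. split; lra. }
  rewrite Ez, Rabs_mult, (Rabs_pos_eq (theta * lambda ^ i)) by nra.
  assert (Hz : w <= Rabs (x - z)).
  { assert (Hvu : v + w <= u + h) by nra.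
    (* Zeros in the enlarged window are those listed in [L]; any other is farther than [h], hence
       than [w], from [x], which lies between [u] and [u + h]. *)
    destruct (classic (u - h <= z <= u + 2 * h)) as [H|H].
    - destruct (Hv2 z (HL2 i b n Hi Hb H)) as [H1|H1].
      + rewrite Rabs_pos_eq; lra.
      + rewrite Rabs_left1; lra.
    - destruct (Rle_or_lt (u - h) z) as [H1|H1].
      + assert (u + 2 * h < z) by (apply Rnot_le_lt; intros H2; apply H; lra).
        rewrite Rabs_left1; lra.
      + rewrite Rabs_pos_eq; lra. }
  apply Rmult_le_compat; nra.
Qed.

(** The order of quantifiers matters: [s] is fixed before [u] and [n], so one bound serves every
    number of levels. *)
Lemma good_point (theta lambda hmax : R) (l : list R) :
  0 < theta -> 1 < lambda -> 0 < hmax ->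
  exists s, 0 < s /\ forall u n, exists x, u <= x <= u + hmax /\
    forall k b, (k < n)%nat -> In b l ->
      s <= Rabs (sin (theta * (lambda ^ k * x) - b)).
Proof.
  intros Ht Hl Hm.
  destruct (good_subinterval theta lambda hmax l Ht Hl Hm)
    as [h [r [s [Hh [Hr [Hs step]]]]]].
  exists s. split; [exact Hs|]. intros u.
  assert (nested : forall m, exists v, u <= v /\ v + h / lambda ^ (r * m) <= u + h /\
    forall x k b, v <= x <= v + h / lambda ^ (r * m) -> (k < r * m)%nat -> In b l ->
      s <= Rabs (sin (theta * (lambda ^ k * x) - b))).
  { induction m as [|m [v [Hv1 [Hv2 Hv3]]]].
    - exists u. rewrite Nat.mul_0_r. simpl. split; [lra|]. split; [lra|]. intros; lia.
    - pose (q := lambda ^ (r * m)). fold q in Hv2, Hv3.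
      assert (Hq : 0 < q) by (apply pow_lt; lra).
      assert (Hp : 0 < lambda ^ r) by (apply pow_lt; lra).
      (* Magnified by [q], the current interval has length [h] again, and level [k] becomes level
         [k - r * m]; the next [r] levels are handled there and scaled back. *)
      destruct (step (q * v)) as [y [Hy1 [Hy2 Hy3]]].
      assert (Eq : lambda ^ (r * S m) = q * lambda ^ r).
      { unfold q. rewrite <- pow_add. f_equal. lia. }
      assert (Ey : q * (y / q) = y) by (field; lra).
      assert (Ew : q * (h / (q * lambda ^ r)) = h / lambda ^ r) by (field; lra).
      assert (Eh : q * (h / q) = h) by (field; lra).
      exists (y / q). rewrite Eq.
      assert (A1 : v <= y / q) by (apply Rmult_le_reg_l with q; lra).
      assert (A2 : y / q + h / (q * lambda ^ r) <= v + h / q)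
        by (apply Rmult_le_reg_l with q; lra).
      split; [lra|]. split; [lra|].
      intros x k b Hx Hk Hb.
      destruct (Nat.lt_ge_cases k (r * m)) as [H|H].
      + apply Hv3; trivial; lra.
      + replace (lambda ^ k * x) with (lambda ^ (k - r * m) * (q * x)).
        * apply Hy3; [|lia|exact Hb]. rewrite <- Ey, <- Ew. nra.
        * unfold q. rewrite <- Rmult_assoc, <- pow_add. do 2 f_equal. lia. }
  (* As [r] is positive, [n] stages cover [r * n >= n] levels. *)
  intros n. destruct (nested n) as [v [Hv1 [Hv2 Hv3]]].
  assert (0 < h / lambda ^ (r * n)) by (apply Rdiv_lt_0_compat; [lra|apply pow_lt; lra]).
  exists v. split; [lra|]. intros k b Hk Hb. apply Hv3; [lra|nia|exact Hb].
Qed.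

(** * Fourier transform on a bounded interval *)

Definition everywhere_continuous (f : R -> R) : Prop := forall x, continuous f x.

Lemma ex_RInt_everywhere_continuous (f : R -> R) (a b : R) :
  everywhere_continuous f -> ex_RInt f a b.
Proof.
  intros H. apply (ex_RInt_continuous (V := R_CompleteNormedModule)). intros z _. apply H.
Qed.

Lemma everywhere_continuous_mult (f g : R -> R) :
  everywhere_continuous f -> everywhere_continuous g ->
  everywhere_continuous (fun x => f x * g x).
Proof.
  intros Hf Hg x. apply (continuous_mult (K := R_AbsRing)); [apply Hf|apply Hg].
Qed.

Lemma everywhere_continuous_derivable (f : R -> R) :
  (forall x, ex_derive f x) -> everywhere_continuous f.
Proof.
  intros H x. now apply (ex_derive_continuous (K := R_AbsRing) (V := R_NormedModule)).
Qed.

Lemma everywhere_continuous_cos_affine (a b : R) :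
  everywhere_continuous (fun x => cos (a * x + b)).
Proof.
  apply everywhere_continuous_derivable. intros x. now auto_derive.
Qed.

Lemma RInt_sum_f_R0 (u : nat -> R -> R) (a b : R) (N : nat) :
  (forall j, (j <= N)%nat -> everywhere_continuous (u j)) ->
  RInt (fun x => sum_f_R0 (fun j => u j x) N) a b = sum_f_R0 (fun j => RInt (u j) a b) N.
Proof.
  intros Hu.
  assert (H : ex_RInt (fun x => sum_f_R0 (fun j => u j x) N) a b /\
    RInt (fun x => sum_f_R0 (fun j => u j x) N) a b = sum_f_R0 (fun j => RInt (u j) a b) N).
  { induction N as [|N IH]; simpl.
    - split; [|reflexivity]. apply ex_RInt_everywhere_continuous, Hu. lia.
    - destruct IH as [IH1 IH2]; [intros; apply Hu; lia|].
      assert (H : ex_RInt (u (S N)) a b) by (apply ex_RInt_everywhere_continuous, Hu; lia).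
      split.
      + now apply (ex_RInt_plus (V := R_NormedModule) _ (u (S N))).
      + rewrite <- IH2. now apply (RInt_plus (V := R_CompleteNormedModule) _ (u (S N))). }
  apply H.
Qed.

Lemma RInt_zero_outside (g : R -> R) (A a b : R) :
  0 <= A -> everywhere_continuous g -> (forall x, A < Rabs x -> g x = 0) ->
  a <= - A -> A <= b -> RInt g a b = RInt g (- A) A.
Proof.
  intros HA Hg H0 Ha Hb.
  rewrite <- (RInt_Chasles g a (- A) b), <- (RInt_Chasles g (- A) A b)
    by now apply ex_RInt_everywhere_continuous.
  rewrite (RInt_ext g (fun _ => 0) a (- A)), (RInt_ext g (fun _ => 0) A b).
  - rewrite !RInt_const. unfold scal, plus; simpl. unfold mult; simpl. ring.
  - intros x Hx. rewrite Rmin_left, Rmax_right in Hx by lra.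
    apply H0. rewrite Rabs_pos_eq; lra.
  - intros x Hx. rewrite Rmin_left, Rmax_right in Hx by lra.
    apply H0. rewrite Rabs_left1; lra.
Qed.

Lemma RInt_dilation (g : R -> R) (A B lambda d : R) :
  1 < lambda -> 0 <= A -> A + Rabs d <= B ->
  everywhere_continuous g -> (forall x, A < Rabs x -> g x = 0) ->
  RInt (fun x => g (lambda * x - d)) (- B) B = / lambda * RInt g (- B) B.
Proof.
  intros Hl HA HB Hg H0.
  pose proof (Rle_abs d). pose proof (Rle_abs (- d)). rewrite Rabs_Ropp in *.
  assert (Hc : everywhere_continuous (fun x => g (lambda * x - d))).
  { intros x. apply (continuous_comp (fun x => lambda * x - d) g); [|apply Hg].
    apply (ex_derive_continuous (K := R_AbsRing) (V := R_NormedModule)). now auto_derive. }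
  assert (E : RInt (fun x => lambda * g (lambda * x + - d)) (- B) B = RInt g (- B) B).
  { etransitivity; [apply (RInt_comp_lin (V := R_CompleteNormedModule) g lambda (- d))|].
    - now apply ex_RInt_everywhere_continuous.
    (* The transformed limits [- lambda * B - d] and [lambda * B - d] still enclose the interval
       from [- A] to [A], because [B >= A + Rabs d]. *)
    - rewrite (RInt_zero_outside g A (- B) B), (RInt_zero_outside g A); trivial; nra. }
  rewrite <- E.
  rewrite (RInt_scal (V := R_CompleteNormedModule) (fun x => g (lambda * x + - d))).
  - change scal with Rmult. rewrite <- Rmult_assoc, Rinv_l, Rmult_1_l by lra. reflexivity.
  - now apply ex_RInt_everywhere_continuous.
Qed.

(* The real part of [e^{i theta}] times the Fourier transform at [-xi], when [f]
   is supported in [[-B, B]]. *)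
Definition fourier (B : R) (f : R -> R) (xi theta : R) : R :=
  RInt (fun x => f x * cos (xi * x + theta)) (- B) B.

Lemma ex_RInt_fourier (B : R) (f : R -> R) (xi theta : R) :
  everywhere_continuous f -> ex_RInt (fun x => f x * cos (xi * x + theta)) (- B) B.
Proof.
  intros Hf. apply ex_RInt_everywhere_continuous, everywhere_continuous_mult; [exact Hf|].
  apply everywhere_continuous_cos_affine.
Qed.

(** The phases 0 and [- (PI / 2)] give the cosine and sine transforms; the addition formula reduces
    every other phase to these. *)
Lemma fourier_phase (B : R) (f : R -> R) (xi theta : R) :
  everywhere_continuous f ->
  fourier B f xi theta =
    cos theta * fourier B f xi 0 - sin theta * fourier B f xi (- (PI / 2)).
Proof.
  intros Hf. unfold fourier. symmetry.
  etransitivity.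
  { apply f_equal2; symmetry; apply (RInt_scal (V := R_CompleteNormedModule));
      now apply ex_RInt_fourier. }
  etransitivity.
  { symmetry. apply (RInt_minus (V := R_CompleteNormedModule));
      apply (ex_RInt_scal (V := R_NormedModule)); now apply ex_RInt_fourier. }
  apply RInt_ext. intros x _. unfold minus, plus, opp, scal; simpl. unfold mult; simpl.
  rewrite !cos_plus, cos_neg, sin_neg, cos_PI2, sin_PI2, cos_0, sin_0. ring.
Qed.

(** Substituting [y = lambda * x - d j] turns the argument [lambda * xi * x + theta] into
    [xi * y + (theta + xi * d j)]: each translation becomes a phase shift. *)
Lemma refinement_fourier (lambda : R) (N : nat) (c : nat -> R) (d : nat -> Q)
    (f : R -> R) (A B xi theta : R) :
  1 < lambda -> 0 <= A -> (forall j, (j <= N)%nat -> A + Rabs (Q2R (d j)) <= B) ->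
  everywhere_continuous f -> (forall x, A < Rabs x -> f x = 0) ->
  refinement_equation lambda N c d f ->
  fourier B f (lambda * xi) theta =
    / lambda * sum_f_R0 (fun j => c j * fourier B f xi (theta + xi * Q2R (d j))) N.
Proof.
  intros Hl HA HB Hf H0 Hr. unfold fourier.
  pose (g j x := f x * cos (xi * x + (theta + xi * Q2R (d j)))).
  assert (Hg : forall j, everywhere_continuous (g j)).
  { intros j. apply everywhere_continuous_mult; [exact Hf|].
    apply everywhere_continuous_cos_affine. }
  assert (Hgl : forall j, everywhere_continuous (fun x => g j (lambda * x - Q2R (d j)))).
  { intros j x. apply (continuous_comp (fun x => lambda * x - Q2R (d j)) (g j)); [|apply Hg].
    apply (ex_derive_continuous (K := R_AbsRing) (V := R_NormedModule)). now auto_derive. }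
  rewrite (RInt_ext _ (fun x => sum_f_R0 (fun j => c j * g j (lambda * x - Q2R (d j))) N)).
  - rewrite RInt_sum_f_R0.
    + rewrite scal_sum. apply sum_eq. intros j Hj.
      etransitivity; [apply (RInt_scal (V := R_CompleteNormedModule)
                               (fun x => g j (lambda * x - Q2R (d j))))|].
      * now apply ex_RInt_everywhere_continuous.
      * change scal with Rmult. cbv beta. rewrite (RInt_dilation (g j) A B); trivial.
        -- unfold g. ring.
        -- now apply HB.
        -- intros x Hx. unfold g. rewrite H0 by exact Hx. ring.
    + intros j Hj. apply (everywhere_continuous_mult (fun _ => c j)); [|apply Hgl].
      intros x. apply continuous_const.
  - intros x _. rewrite (Hr x), (Rmult_comm _ (cos _)), scal_sum. apply sum_eq. intros j _.
    unfold g.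
    replace (xi * (lambda * x - Q2R (d j)) + (theta + xi * Q2R (d j)))
      with (lambda * xi * x + theta) by ring. ring.
Qed.

(** * Decay and Lipschitz continuity of the transform *)

Lemma bounded_on_interval (f : R -> R) (B : R) :
  0 <= B -> everywhere_continuous f ->
  exists M, 0 <= M /\ forall x, - B <= x <= B -> Rabs (f x) <= M.
Proof.
  intros HB Hf.
  destruct (continuity_ab_maj (fun x => Rabs (f x)) (- B) B) as [m [Hm _]].
  - lra.
  - intros x _. apply (continuity_pt_comp f Rabs); [|apply Rcontinuity_abs].
    apply continuity_pt_filterlim, Hf.
  - exists (Rabs (f m)). split; [apply Rabs_pos|exact Hm].
Qed.

Lemma smooth_derivable (f : R -> R) : smooth f -> forall x, ex_derive f x.
Proof. intros H x. exact (H 1%nat x). Qed.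

Lemma smooth_Derive (f : R -> R) : smooth f -> smooth (Derive f).
Proof.
  intros H n x. destruct n as [|n]; [exact I|]. simpl.
  apply ex_derive_ext with (Derive_n f (S n)).
  - intros t. symmetry. rewrite <- Nat.add_1_r. exact (Derive_n_comp f n 1 t).
  - exact (H (S (S n)) x).
Qed.

Lemma Derive_zero_outside (f : R -> R) (A : R) :
  (forall x, A < Rabs x -> f x = 0) -> forall x, A < Rabs x -> Derive f x = 0.
Proof.
  intros H0 x Hx. rewrite (Derive_ext_loc f (fun _ => 0)); [apply Derive_const|].
  assert (He : 0 < Rabs x - A) by lra.
  exists (mkposreal _ He). intros y Hy. apply H0.
  change (Rabs (y - x) < Rabs x - A) in Hy.
  pose proof (Rabs_triang_inv x y). rewrite Rabs_minus_sym in Hy. lra.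
Qed.

(** Integration by parts; the boundary terms vanish since [A < B]. The sine is written as a cosine
    shifted by [PI / 2], so that the result is again a [fourier]. *)
Lemma fourier_Derive (f : R -> R) (A B xi theta : R) :
  smooth f -> (forall x, A < Rabs x -> f x = 0) -> 0 <= A < B ->
  xi * fourier B f xi theta = - fourier B (Derive f) xi (theta - PI / 2).
Proof.
  intros Hs H0 HAB. pose proof (smooth_derivable f Hs) as Hd.
  pose proof (everywhere_continuous_derivable _ Hd) as Hc.
  pose proof (everywhere_continuous_derivable _ (smooth_derivable _ (smooth_Derive f Hs))) as Hc'.
  assert (E : is_RInt (fun x => plus (Derive f x * cos (xi * x + (theta - PI / 2)))
                                   (xi * (f x * cos (xi * x + theta)))) (- B) B
                 (minus (f B * sin (xi * B + theta)) (f (- B) * sin (xi * - B + theta)))).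
  { apply (is_RInt_derive (V := R_CompleteNormedModule) (fun x => f x * sin (xi * x + theta))).
    - intros x _. auto_derive; [apply Hd|].
      replace (xi * x + (theta - PI / 2)) with (- (PI / 2 - (xi * x + theta))) by ring.
      rewrite cos_neg, cos_shift. unfold plus; simpl.
      change (Derive (fun y => f y) x) with (Derive f x). ring.
    - intros x _. apply (continuous_plus (V := R_NormedModule)).
      + apply (everywhere_continuous_mult (Derive f)); [exact Hc'|].
        apply everywhere_continuous_cos_affine.
      + apply (everywhere_continuous_mult (fun _ => xi)).
        * intros y. apply continuous_const.
        * apply everywhere_continuous_mult; [exact Hc|].
          apply everywhere_continuous_cos_affine. }
  apply (is_RInt_unique (V := R_CompleteNormedModule)) in E.
  rewrite (H0 B), (H0 (- B)) in E by (rewrite ?Rabs_Ropp, Rabs_pos_eq; lra).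
  rewrite (RInt_plus (V := R_CompleteNormedModule)) in E.
  - rewrite (RInt_scal (V := R_CompleteNormedModule)
               (fun x => f x * cos (xi * x + theta))) in E by now apply ex_RInt_fourier.
    unfold plus, minus, opp, scal in E; simpl in E. unfold mult, plus in E; simpl in E.
    unfold fourier. lra.
  - now apply ex_RInt_fourier.
  - apply (ex_RInt_scal (V := R_NormedModule) (fun x => f x * cos (xi * x + theta))).
    now apply ex_RInt_fourier.
Qed.

Lemma fourier_decay (f : R -> R) (A B : R) (n : nat) :
  smooth f -> (forall x, A < Rabs x -> f x = 0) -> 0 <= A < B ->
  exists K, forall xi theta, Rabs (xi ^ n * fourier B f xi theta) <= K.
Proof.
  revert f. induction n as [|n IH]; intros f Hs H0 HAB.
  - pose proof (everywhere_continuous_derivable _ (smooth_derivable f Hs)) as Hc.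
    destruct (bounded_on_interval f B) as [M [HM0 HM]]; [lra|exact Hc|].
    exists ((B - - B) * M). intros xi theta. simpl. rewrite Rmult_1_l.
    apply abs_RInt_le_const; [lra|now apply ex_RInt_fourier|].
    intros t Ht. rewrite Rabs_mult, <- (Rmult_1_r M).
    apply Rmult_le_compat; try apply Rabs_pos; [now apply HM|].
    apply Rabs_le, COS_bound.
  - destruct (IH (Derive f)) as [K HK].
    + now apply smooth_Derive.
    + now apply Derive_zero_outside.
    + exact HAB.
    + exists K. intros xi theta.
      replace (xi ^ S n * fourier B f xi theta) with (xi ^ n * (xi * fourier B f xi theta))
        by (simpl; ring).
      rewrite (fourier_Derive f A) by trivial.
      rewrite Ropp_mult_distr_r_reverse, Rabs_Ropp. apply HK.
Qed.

Lemma cos_lipschitz (a b : R) : Rabs (cos a - cos b) <= Rabs (a - b).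
Proof.
  destruct (MVT_gen cos b a (fun x => - sin x)) as [z [_ Hz]].
  - intros x _. auto_derive; [trivial|ring].
  - intros x _. apply continuity_cos.
  - rewrite Hz, Rabs_mult. rewrite <- (Rmult_1_l (Rabs (a - b))) at 2.
    apply Rmult_le_compat_r; [apply Rabs_pos|]. rewrite Rabs_Ropp. apply Rabs_le, SIN_bound.
Qed.

Lemma fourier_lipschitz (f : R -> R) (B : R) :
  0 <= B -> everywhere_continuous f ->
  exists K, 0 <= K /\ forall xi xi' theta,
    Rabs (fourier B f xi theta - fourier B f xi' theta) <= K * Rabs (xi - xi').
Proof.
  intros HB Hf. destruct (bounded_on_interval f B HB Hf) as [M [HM0 HM]].
  (* Length of the interval, times the bound [M] of [f], times the bound [B] of the factor that
     multiplies the change of frequency. *)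
  exists ((B - - B) * (M * B)). split; [apply Rmult_le_pos; nra|]. intros xi xi' theta.
  unfold fourier.
  assert (E := RInt_minus (V := R_CompleteNormedModule) _ _ (- B) B
    (ex_RInt_fourier B f xi theta Hf) (ex_RInt_fourier B f xi' theta Hf)).
  unfold minus, plus, opp in E; simpl in E. unfold Rminus. rewrite <- E.
  rewrite Rmult_assoc. apply abs_RInt_le_const; [lra| |].
  - apply (ex_RInt_minus (V := R_NormedModule)); now apply ex_RInt_fourier.
  - intros t Ht.
    replace (f t * cos (xi * t + theta) + - (f t * cos (xi' * t + theta)))
      with (f t * (cos (xi * t + theta) - cos (xi' * t + theta))) by ring.
    rewrite Rabs_mult, Rmult_assoc. apply Rmult_le_compat; try apply Rabs_pos; [now apply HM|].
    eapply Rle_trans; [apply cos_lipschitz|].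
    replace (xi * t + theta - (xi' * t + theta)) with (t * (xi + - xi')) by ring.
    rewrite Rabs_mult. apply Rmult_le_compat_r; [apply Rabs_pos|]. apply Rabs_le; lra.
Qed.

(** * Injectivity of the transform *)

Lemma RInt_kernel_fourier (f : R -> R) (B a b : R) (n : nat) :
  everywhere_continuous f -> (forall xi theta, fourier B f xi theta = 0) ->
  forall xi theta,
    RInt (fun x => f x * (1 + cos (a * x + b)) ^ n * cos (xi * x + theta)) (- B) B = 0.
Proof.
  intros Hf HF.
  assert (Hc : forall n, everywhere_continuous (fun x => f x * (1 + cos (a * x + b)) ^ n)).
  { intros m. apply everywhere_continuous_mult; [exact Hf|].
    apply everywhere_continuous_derivable. intros x. now auto_derive. }
  induction n as [|n IH]; intros xi theta.
  - rewrite <- (HF xi theta). apply RInt_ext. intros x _. simpl. ring.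
  - pose (g x := f x * (1 + cos (a * x + b)) ^ n).
    pose (w s t x := g x * cos (s * x + t)).
    assert (Hw : forall s t, is_RInt (w s t) (- B) B 0).
    { intros s t. rewrite <- (IH s t). apply (RInt_correct (V := R_CompleteNormedModule)).
      apply ex_RInt_fourier, Hc. }
    (* By the product-to-sum formula, one more factor [1 + cos (a * x + b)] yields a combination of
       integrals at the frequencies [xi], [xi + a] and [xi - a]; all vanish by induction. *)
    pose proof (is_RInt_plus _ _ _ _ _ _ (Hw (xi + a) (theta + b)) (Hw (xi - a) (theta - b))) as H1.
    pose proof (is_RInt_plus _ _ _ _ _ _ (Hw xi theta) (is_RInt_scal _ _ _ (/ 2) _ H1)) as H2.
    apply (is_RInt_unique (V := R_CompleteNormedModule)).
    replace 0 with (plus 0 (scal (/ 2) (plus 0 0)))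
      by (unfold plus, scal; simpl; unfold mult; simpl; ring).
    refine (is_RInt_ext _ _ _ _ _ _ H2).
    intros x _. unfold w, g, plus, scal; simpl. unfold mult; simpl.
    replace ((xi + a) * x + (theta + b)) with ((xi * x + theta) + (a * x + b)) by ring.
    replace ((xi - a) * x + (theta - b)) with ((xi * x + theta) - (a * x + b)) by ring.
    rewrite (cos_plus (xi * x + theta) (a * x + b)), (cos_minus (xi * x + theta) (a * x + b)).
    field.
Qed.

Lemma powers_not_dominated (p q K c : R) :
  0 < p < q -> 0 < c -> exists n : nat, K * p ^ n < c * q ^ n.
Proof.
  intros Hpq Hc.
  assert (H1 : 1 < q / p) by (apply Rlt_div_r; lra).
  destruct (Pow_x_infinity (q / p)) with (b := Rabs K / c + 1) as [n Hn].
  { rewrite Rabs_pos_eq; lra. }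
  exists n. specialize (Hn n (Nat.le_refl n)).
  assert (Hp : 0 < p ^ n) by (apply pow_lt; lra).
  assert (Hqp : 0 < (q / p) ^ n) by (apply pow_lt; lra).
  rewrite Rabs_pos_eq in Hn by lra.
  assert (E : q ^ n = (q / p) ^ n * p ^ n).
  { rewrite <- Rpow_mult_distr. f_equal. field. lra. }
  assert (K < c * (q / p) ^ n).
  { apply Rle_lt_trans with (c * (Rabs K / c)); [|nra].
    replace (c * (Rabs K / c)) with (Rabs K) by (field; lra). apply Rle_abs. }
  rewrite E. nra.
Qed.

(* The kernel [(1 + cos (s (x - x0))) ^ n] concentrates at [x0] as [n] grows. *)
Lemma fourier_zero_nonpositive (f : R -> R) (A B x0 : R) :
  0 <= A < B -> everywhere_continuous f -> (forall x, A < Rabs x -> f x = 0) ->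
  (forall xi theta, fourier B f xi theta = 0) -> f x0 <= 0.
Proof.
  intros HAB Hf H0 HF. apply Rnot_lt_le. intros Hpos.
  assert (Hx0 : - A <= x0 <= A).
  { apply Rabs_le_between, Rnot_lt_le. intros H. rewrite (H0 x0 H) in Hpos. lra. }
  assert (exists h, 0 < h <= B - A /\ forall x, Rabs (x - x0) <= h -> f x0 / 2 <= f x)
    as [h [Hh Hfh]].
  { assert (Hc : continuity_pt f x0) by apply continuity_pt_filterlim, Hf.
    destruct (Hc (f x0 / 2)) as [alp [Halp Hc']]; [lra|].
    exists (Rmin (alp / 2) (B - A)). split.
    - split; [apply Rmin_glb_lt; lra|apply Rmin_r].
    - intros x Hx. destruct (Req_dec x x0) as [E|E]; [subst; lra|].
      assert (Hd : Rabs (f x - f x0) < f x0 / 2).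
      { apply (Hc' x). split; [split; [exact I|now apply not_eq_sym]|].
        pose proof (Rmin_l (alp / 2) (B - A)).
        change (Rabs (x - x0) < alp). lra. }
      apply Rabs_lt_between in Hd. lra. }
  destruct (bounded_on_interval f B) as [M [HM0 HM]]; [lra|exact Hf|].
  (* For points of the interval, [Rabs (x - x0) <= 2 * B], so the cosine's argument is at most 1,
     below [PI / 2]: there [psi] is positive and decreases with the distance. *)
  pose (s := / (2 * B)).
  assert (Hs : 0 < s) by (apply Rinv_0_lt_compat; lra).
  assert (HsB : s * (2 * B) = 1) by (unfold s; field; lra).
  pose (psi y := 1 + cos (s * y)).
  pose proof PI2_1 as Hpi.
  assert (Hdecr : forall y z, 0 <= y -> y <= z -> z <= 2 * B -> psi z <= psi y).
  { intros y z Hy Hyz Hz. unfold psi. apply Rplus_le_compat_l. apply cos_decr_1; nra. }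
  assert (Habs : forall y, psi y = psi (Rabs y)).
  { intros y. unfold psi. unfold Rabs. destruct (Rcase_abs y); [|reflexivity].
    rewrite <- cos_neg. do 2 f_equal. ring. }
  assert (Hpos' : forall y, Rabs y <= 2 * B -> 0 < psi y).
  { intros y Hy. unfold psi. apply Rabs_le_between in Hy.
    enough (0 < cos (s * y)) by lra. apply cos_gt_0; nra. }
  assert (Hq : 0 < psi h < psi (h / 2)).
  { split; [apply Hpos'; rewrite Rabs_pos_eq; lra|].
    unfold psi. apply Rplus_lt_compat_l. apply cos_decreasing_1; nra. }
  (* For this [n] the positive contribution within [h / 2] of [x0] outweighs any negative one, which
     can only come from beyond distance [h]. *)
  destruct (powers_not_dominated (psi h) (psi (h / 2)) (2 * B * M) (f x0 / 2 * h) Hq)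
    as [n Hn]; [nra|].
  pose (g x := f x * psi (x - x0) ^ n).
  assert (Hg : everywhere_continuous g).
  { apply everywhere_continuous_mult; [exact Hf|].
    apply everywhere_continuous_derivable. intros x. unfold psi. now auto_derive. }
  assert (Hg0 : RInt g (- B) B = 0).
  { rewrite <- (RInt_kernel_fourier f B s (- (s * x0)) n Hf HF 0 0).
    apply RInt_ext. intros x _. unfold g, psi.
    rewrite Rmult_0_l, Rplus_0_l, cos_0, Rmult_1_r. do 4 f_equal. ring. }
  assert (Hout : forall x, - B <= x <= B -> - (M * psi h ^ n) <= g x).
  { intros x Hx. unfold g. specialize (HM x Hx). apply Rabs_le_between in HM.
    assert (Hx2 : Rabs (x - x0) <= 2 * B) by (apply Rabs_le; lra).
    assert (Hp : 0 < psi (x - x0) ^ n) by (apply pow_lt, Hpos', Hx2).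
    assert (Hph : 0 < psi h ^ n) by (apply pow_lt; lra).
    destruct (Rle_or_lt (Rabs (x - x0)) h) as [H|H].
    - specialize (Hfh x H). nra.
    - assert (psi (x - x0) ^ n <= psi h ^ n).
      { apply pow_incr. split; [apply Rlt_le, Hpos', Hx2|].
        rewrite (Habs (x - x0)). apply Hdecr; lra. }
      nra. }
  assert (Hin : forall x, x0 - h / 2 <= x <= x0 + h / 2 -> f x0 / 2 * psi (h / 2) ^ n <= g x).
  { intros x Hx. unfold g.
    assert (Hx2 : Rabs (x - x0) <= h / 2) by (apply Rabs_le; lra).
    assert (0 < psi (h / 2) ^ n) by (apply pow_lt; lra).
    apply Rmult_le_compat; [lra|lra|apply Hfh; lra|].
    apply pow_incr. split; [lra|]. rewrite (Habs (x - x0)).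
    apply Hdecr; [apply Rabs_pos|lra|lra]. }
  assert (Hconst : forall k a b, a <= b -> (forall x, a <= x <= b -> k <= g x) ->
    (b - a) * k <= RInt g a b).
  { intros k a b Hab Hk.
    replace ((b - a) * k) with (RInt (fun _ => k) a b)
      by (rewrite RInt_const; reflexivity).
    apply RInt_le; trivial.
    - apply ex_RInt_const.
    - now apply ex_RInt_everywhere_continuous.
    - intros x Hx. apply Hk. lra. }
  rewrite <- (RInt_Chasles g (- B) (x0 - h / 2) B),
    <- (RInt_Chasles g (x0 - h / 2) (x0 + h / 2) B) in Hg0
    by now apply ex_RInt_everywhere_continuous.
  unfold plus in Hg0; simpl in Hg0.
  pose proof (Hconst (- (M * psi h ^ n)) (- B) (x0 - h / 2)) as I1.
  pose proof (Hconst (f x0 / 2 * psi (h / 2) ^ n) (x0 - h / 2) (x0 + h / 2)) as I2.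
  pose proof (Hconst (- (M * psi h ^ n)) (x0 + h / 2) B) as I3.
  specialize (I1 ltac:(lra) ltac:(intros; apply Hout; lra)).
  specialize (I2 ltac:(lra) ltac:(intros; apply Hin; lra)).
  specialize (I3 ltac:(lra) ltac:(intros; apply Hout; lra)).
  assert (0 <= M * psi h ^ n) by (apply Rmult_le_pos; [lra|apply pow_le; lra]).
  nra.
Qed.

(** The one-sided bound is applied to both [f] and [- f]. *)
Lemma fourier_injective (f : R -> R) (A B : R) :
  0 <= A < B -> everywhere_continuous f -> (forall x, A < Rabs x -> f x = 0) ->
  (forall xi theta, fourier B f xi theta = 0) -> forall x, f x = 0.
Proof.
  intros HAB Hf H0 HF x. apply Rle_antisym.
  - now apply (fourier_zero_nonpositive f A B).
  - enough (- f x <= 0) by lra.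
    apply (fourier_zero_nonpositive (fun x => - f x) A B); trivial.
    + intros y. apply (continuous_opp (V := R_NormedModule)), Hf.
    + intros y Hy. rewrite H0 by exact Hy. ring.
    + intros xi theta. unfold fourier.
      etransitivity.
      { apply (RInt_ext _ (fun x => opp (f x * cos (xi * x + theta)))).
        intros y _. unfold opp; simpl. ring. }
      rewrite (RInt_opp (V := R_CompleteNormedModule)) by now apply ex_RInt_fourier.
      unfold opp; simpl. rewrite <- Ropp_0. f_equal. apply HF.
Qed.

(** * The refinement equation *)

Lemma common_denominator (d : nat -> Q) (N : nat) :
  exists q : R, 0 < q /\
    forall j, (j <= N)%nat -> exists k : Z, q * Q2R (d j) = IZR k.
Proof.
  assert (H : exists q : Z, (0 < q)%Z /\
    forall j, (j <= N)%nat -> exists k : Z, IZR q * Q2R (d j) = IZR k).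
  { assert (Hden : forall x : Q, IZR (QDen x) * Q2R x = IZR (Qnum x)).
    { intros x. unfold Q2R. field. apply eq_IZR_contrapositive. discriminate. }
    induction N as [|N [q [Hq IH]]].
    - exists (QDen (d 0%nat)). split; [reflexivity|].
      intros j Hj. replace j with 0%nat by lia. exists (Qnum (d 0%nat)). apply Hden.
    - exists (q * QDen (d (S N)))%Z. split; [apply Z.mul_pos_pos; [exact Hq|reflexivity]|].
      intros j Hj. rewrite mult_IZR. destruct (Nat.eq_dec j (S N)) as [E|E].
      + subst j. exists (q * Qnum (d (S N)))%Z. rewrite mult_IZR, <- Hden. ring.
      + destruct (IH j) as [k Hk]; [lia|]. exists (QDen (d (S N)) * k)%Z.
        rewrite mult_IZR, <- Hk. ring. }
  destruct H as [q [Hq H]]. exists (IZR q). split; [now apply IZR_lt|exact H].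
Qed.

(** The frequencies [q * (d j - d 0)] are increasing natural numbers, so each new Chebyshev
    polynomial has a degree above all earlier ones and alone fixes the leading coefficient. The
    equation for [INR p] lets the induction compare degrees. *)
Lemma cos_sum_polynomial (c : nat -> R) (d : nat -> Q) (N : nat) (q : R) :
  0 < q ->
  (forall j, (j <= N)%nat -> exists k : Z, q * Q2R (d j) = IZR k) ->
  (forall j, (j < N)%nat -> (d j < d (S j))%Q) ->
  exists p a T, INR p = q * (Q2R (d N) - Q2R (d 0%nat)) /\
    0 < a /\ polynomial p (c N * a) T /\
    forall t, T (cos t) =
      sum_f_R0 (fun j => c j * cos (q * (Q2R (d j) - Q2R (d 0%nat)) * t)) N.
Proof.
  intros Hq. induction N as [|N IH]; intros Hk Hd.
  - exists 0%nat, 1, (fun _ => c 0%nat). simpl. split; [ring|]. split; [lra|].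
    split; [intros; ring|]. intros t. rewrite Rminus_diag, Rmult_0_r, Rmult_0_l, cos_0. ring.
  - destruct IH as [p [a [T [Hp [Ha [HT ET]]]]]]; [intros; apply Hk; lia|intros; apply Hd; lia|].
    destruct (Hk (S N)) as [k Hk1]; [lia|]. destruct (Hk 0%nat) as [k0 Hk0]; [lia|].
    assert (Hlt : Q2R (d N) < Q2R (d (S N))) by (apply Qlt_Rlt, Hd; lia).
    assert (Hkk : IZR (k - k0) = q * (Q2R (d (S N)) - Q2R (d 0%nat))).
    { rewrite minus_IZR, <- Hk1, <- Hk0. ring. }
    assert (Hpk : INR p < IZR (k - k0)) by (rewrite Hp, Hkk; apply Rmult_lt_compat_l; lra).
    rewrite INR_IZR_INZ in Hpk. apply lt_IZR in Hpk.
    pose (p' := Z.to_nat (k - k0)).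
    assert (Ep : INR p' = q * (Q2R (d (S N)) - Q2R (d 0%nat))).
    { unfold p'. rewrite INR_IZR_INZ, Z2Nat.id by lia. exact Hkk. }
    destruct (chebyshev p') as [b [U [Hb [HU EU]]]].
    exists p', b, (fun x => T x + c (S N) * U x). split; [exact Ep|]. split; [exact Hb|]. split.
    + rewrite <- (Rplus_0_l (c (S N) * b)). apply polynomial_plus.
      * apply polynomial_raise with p (c N * a); [unfold p'; lia|exact HT].
      * now apply polynomial_scal.
    + intros t. simpl. now rewrite ET, EU, Ep.
Qed.

Definition symbol_norm2 (c : nat -> R) (d : nat -> Q) (N : nat) (xi : R) : R :=
  (sum_f_R0 (fun j => c j * cos (xi * Q2R (d j))) N) ^ 2 +
  (sum_f_R0 (fun j => c j * sin (xi * Q2R (d j))) N) ^ 2.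

Lemma sum_linear_combination (u v : nat -> R) (x y : R) (N : nat) :
  sum_f_R0 (fun j => u j * x + v j * y) N = x * sum_f_R0 u N + y * sum_f_R0 v N.
Proof.
  induction N as [|N IH]; simpl; [ring|]. rewrite IH. ring.
Qed.

(* Rotating the symbol by [xi * d 0] and taking its real part leaves a cosine sum
   with nonnegative integer frequencies, i.e. a polynomial in one cosine. *)
Lemma symbol_lower_bound (c : nat -> R) (d : nat -> Q) (N : nat) :
  c N <> 0 -> (forall j, (j < N)%nat -> (d j < d (S j))%Q) ->
  exists theta l, 0 < theta /\ forall s, 0 < s -> exists e, 0 < e /\
    forall xi, (forall b, In b l -> s <= Rabs (sin (theta * xi - b))) ->
      e <= symbol_norm2 c d N xi.
Proof.
  intros HcN Hd. destruct (common_denominator d N) as [q [Hq Hk]].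
  destruct (cos_sum_polynomial c d N q Hq Hk Hd) as [p [a [T [_ [Ha [HT ET]]]]]].
  destruct (polynomial_cos_lower_bound p (c N * a) T) as [l Hl]; [|exact HT|].
  { apply Rmult_integral_contrapositive. split; [exact HcN|lra]. }
  (* The polynomial is evaluated at [cos (xi / q)], and its zeros are described through half of that
     angle. *)
  exists (/ (2 * q)), l. split; [apply Rinv_0_lt_compat; lra|].
  intros s Hs. destruct (Hl s Hs) as [e [He Hle]].
  exists (e ^ 2). split; [now apply pow_lt|]. intros xi Hxi.
  specialize (Hle (xi / q)).
  replace (xi / q / 2) with (/ (2 * q) * xi) in Hle by (field; lra).
  specialize (Hle Hxi). rewrite ET in Hle. unfold symbol_norm2.
  set (P := sum_f_R0 (fun j => c j * cos (xi * Q2R (d j))) N).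
  set (S := sum_f_R0 (fun j => c j * sin (xi * Q2R (d j))) N).
  set (y := xi * Q2R (d 0%nat)).
  assert (E : sum_f_R0 (fun j => c j * cos (q * (Q2R (d j) - Q2R (d 0%nat)) * (xi / q))) N
              = cos y * P + sin y * S).
  { unfold P, S. rewrite <- sum_linear_combination. apply sum_eq. intros j _.
    replace (q * (Q2R (d j) - Q2R (d 0%nat)) * (xi / q)) with (xi * Q2R (d j) - y)
      by (unfold y; field; lra).
    rewrite cos_minus. ring. }
  rewrite E in Hle.
  apply Rle_trans with ((cos y * P + sin y * S) ^ 2).
  - rewrite <- (pow2_abs (cos y * P + sin y * S)). apply pow_incr. lra.
  (* The real part of the rotated symbol is at most its modulus; the defect is the square of the
     imaginary part. *)
  - pose proof (sin2_cos2 y) as H1. unfold Rsqr in H1.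
    assert (P ^ 2 + S ^ 2 - (cos y * P + sin y * S) ^ 2
      = (sin y * P - cos y * S) ^ 2
        + (1 - (sin y * sin y + cos y * cos y)) * (P ^ 2 + S ^ 2)) by ring.
    rewrite H1 in H. pose proof (pow2_ge_0 (sin y * P - cos y * S)). lra.
Qed.

(** The two phases are the real and imaginary parts of the integral of [f x] times [e^{i xi x}]. *)
Definition fourier_norm2 (B : R) (f : R -> R) (xi : R) : R :=
  fourier B f xi 0 ^ 2 + fourier B f xi (- (PI / 2)) ^ 2.

Lemma fourier_norm2_dilation (lambda : R) (N : nat) (c : nat -> R) (d : nat -> Q)
    (f : R -> R) (A B xi : R) :
  1 < lambda -> 0 <= A -> (forall j, (j <= N)%nat -> A + Rabs (Q2R (d j)) <= B) ->
  everywhere_continuous f -> (forall x, A < Rabs x -> f x = 0) ->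
  refinement_equation lambda N c d f ->
  fourier_norm2 B f (lambda * xi) =
    / lambda ^ 2 * symbol_norm2 c d N xi * fourier_norm2 B f xi.
Proof.
  intros Hl HA HB Hf H0 Hr. unfold fourier_norm2, symbol_norm2.
  rewrite !(refinement_fourier lambda N c d f A B) by trivial.
  set (F := fourier B f xi 0). set (G := fourier B f xi (- (PI / 2))).
  set (P := sum_f_R0 (fun j => c j * cos (xi * Q2R (d j))) N).
  set (S := sum_f_R0 (fun j => c j * sin (xi * Q2R (d j))) N).
  assert (E1 : sum_f_R0 (fun j => c j * fourier B f xi (0 + xi * Q2R (d j))) N
               = F * P + - G * S).
  { unfold P, S. rewrite <- sum_linear_combination. apply sum_eq. intros j _.
    rewrite (fourier_phase B f xi (0 + _)), Rplus_0_l by exact Hf. unfold F, G. ring. }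
  assert (E2 : sum_f_R0 (fun j => c j * fourier B f xi (- (PI / 2) + xi * Q2R (d j))) N
               = G * P + F * S).
  { unfold P, S. rewrite <- sum_linear_combination. apply sum_eq. intros j _.
    rewrite (fourier_phase B f xi (- (PI / 2) + _)) by exact Hf.
    rewrite cos_plus, sin_plus, cos_neg, sin_neg, cos_PI2, sin_PI2. unfold F, G. ring. }
  (* [E1] and [E2] are the parts of the complex product [(F + i G) (P + i S)], whose squared modulus
     is multiplicative. *)
  rewrite E1, E2. field. lra.
Qed.

Lemma fourier_norm2_ge (B : R) (f : R -> R) (xi theta : R) :
  everywhere_continuous f -> fourier B f xi theta ^ 2 <= fourier_norm2 B f xi.
Proof.
  intros Hf. rewrite (fourier_phase B f xi theta Hf). unfold fourier_norm2.
  set (F := fourier B f xi 0). set (G := fourier B f xi (- (PI / 2))).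
  pose proof (sin2_cos2 theta) as H1. unfold Rsqr in H1.
  assert (H : F ^ 2 + G ^ 2 - (cos theta * F - sin theta * G) ^ 2
      = (sin theta * F + cos theta * G) ^ 2
        + (1 - (sin theta * sin theta + cos theta * cos theta)) * (F ^ 2 + G ^ 2)) by ring.
  rewrite H1 in H. pose proof (pow2_ge_0 (sin theta * F + cos theta * G)). lra.
Qed.

Lemma fourier_norm2_decay (f : R -> R) (A B : R) (n : nat) :
  smooth f -> (forall x, A < Rabs x -> f x = 0) -> 0 <= A < B ->
  exists K, forall xi, (xi ^ n) ^ 2 * fourier_norm2 B f xi <= K.
Proof.
  intros Hs H0 HAB. destruct (fourier_decay f A B n Hs H0 HAB) as [K HK].
  exists (K ^ 2 + K ^ 2). intros xi. unfold fourier_norm2.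
  rewrite Rmult_plus_distr_l, <- !Rpow_mult_distr.
  assert (H : forall theta, (xi ^ n * fourier B f xi theta) ^ 2 <= K ^ 2).
  { intros theta. rewrite <- pow2_abs. apply pow_incr. split; [apply Rabs_pos|apply HK]. }
  apply Rplus_le_compat; apply H.
Qed.

Lemma fourier_norm2_lower_interval (f : R -> R) (B xi0 theta : R) :
  0 <= B -> everywhere_continuous f -> fourier B f xi0 theta <> 0 ->
  exists u h a m, 0 < h /\ 0 < a /\ 0 < m /\
    forall xi, u <= xi <= u + h -> a <= Rabs xi /\ m <= fourier_norm2 B f xi.
Proof.
  intros HB Hf HF. destruct (fourier_lipschitz f B HB Hf) as [K [HK0 HK]].
  set (F := Rabs (fourier B f xi0 theta)).
  assert (HF0 : 0 < F) by now apply Rabs_pos_lt.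
  (* Within [r] of [xi0] the transform changes by at most [F / 2]. *)
  pose (r := F / (2 * (K + 1))).
  assert (Hr : 0 < r) by (apply Rdiv_lt_0_compat; lra).
  assert (HKr : K * r <= F / 2).
  { apply Rle_trans with ((K + 1) * r); [nra|]. unfold r. right. field. lra. }
  assert (Hm : forall xi, Rabs (xi - xi0) <= r -> (F / 2) ^ 2 <= fourier_norm2 B f xi).
  { intros xi Hxi. apply Rle_trans with (fourier B f xi theta ^ 2); [|now apply fourier_norm2_ge].
    rewrite <- (pow2_abs (fourier B f xi theta)). apply pow_incr. split; [lra|].
    specialize (HK xi0 xi theta). rewrite (Rabs_minus_sym xi0) in HK.
    pose proof (Rabs_triang_inv (fourier B f xi0 theta) (fourier B f xi theta)). fold F in H.
    assert (K * Rabs (xi - xi0) <= K * r) by (apply Rmult_le_compat_l; lra). lra. }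
  assert (HF2 : 0 < (F / 2) ^ 2) by (apply pow_lt; lra).
  (* The interval is taken on the side of [xi0] away from 0, so that [Rabs xi >= r / 2] there and
     [lambda ^ n * xi] really escapes to infinity. *)
  destruct (Rle_or_lt 0 xi0).
  - exists (xi0 + r / 2), (r / 2), (r / 2), ((F / 2) ^ 2). repeat split; try lra.
    + rewrite Rabs_pos_eq; lra.
    + apply Hm. rewrite Rabs_pos_eq; lra.
  - exists (xi0 - r), (r / 2), (r / 2), ((F / 2) ^ 2). repeat split; try lra.
    + rewrite Rabs_left1; lra.
    + apply Hm. rewrite Rabs_left1; lra.
Qed.

(** * Geometric lower bound against rapid decay *)

Lemma compactly_supported_zero_outside (f : R -> R) :
  compactly_supported f -> exists A, 0 <= A /\ forall x, A < Rabs x -> f x = 0.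
Proof.
  intros H. destruct (compact_P1 _ H) as [m [M Hb]].
  exists (Rabs m + Rabs M). split; [pose proof (Rabs_pos m); pose proof (Rabs_pos M); lra|].
  intros x Hx. apply NNPP. intros Hn.
  assert (Hm : m <= x <= M) by (apply Hb, adherence_P1, Hn).
  assert (Rabs x <= Rabs m + Rabs M); [|lra].
  unfold Rabs. destruct (Rcase_abs x), (Rcase_abs m), (Rcase_abs M); lra.
Qed.

Lemma sequence_bounded (u : nat -> R) (N : nat) :
  exists D, 0 <= D /\ forall j, (j <= N)%nat -> Rabs (u j) <= D.
Proof.
  induction N as [|N [D [HD IH]]].
  - exists (Rabs (u 0%nat)). split; [apply Rabs_pos|]. intros j Hj.
    replace j with 0%nat by lia. lra.
  - exists (D + Rabs (u (S N))). pose proof (Rabs_pos (u (S N))). split; [lra|].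
    intros j Hj. destruct (Nat.eq_dec j (S N)) as [E|E]; [subst; lra|].
    specialize (IH j ltac:(lia)). lra.
Qed.

Lemma refinable_zero (lambda : R) (N : nat) (c : nat -> R) (d : nat -> Q) (f : R -> R) :
  1 < lambda -> c N <> 0 -> (forall j : nat, (j < N)%nat -> (d j < d (S j))%Q) ->
  smooth f -> compactly_supported f -> refinement_equation lambda N c d f ->
  forall x, f x = 0.
Proof.
  intros Hl HcN Hd Hs Hsupp Hr.
  destruct (compactly_supported_zero_outside f Hsupp) as [A [HA H0]].
  destruct (sequence_bounded (fun j => Q2R (d j)) N) as [D [HD HDj]].
  (* Adding [D] leaves room for all translations; adding 1 makes [A < B] strict, so [f] vanishes at
     the endpoints. *)
  pose (B := A + D + 1).
  assert (HAB : 0 <= A < B) by (unfold B; lra).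
  assert (HB : forall j, (j <= N)%nat -> A + Rabs (Q2R (d j)) <= B).
  { intros j Hj. specialize (HDj j Hj). unfold B. lra. }
  assert (Hf : everywhere_continuous f)
    by now apply everywhere_continuous_derivable, smooth_derivable.
  apply (fourier_injective f A B HAB Hf H0). intros xi0 theta0. apply NNPP. intros HF.
  destruct (fourier_norm2_lower_interval f B xi0 theta0) as [u [h [a [m [Hh [Ha [Hm Hint]]]]]]];
    [lra|exact Hf|exact HF|].
  destruct (symbol_lower_bound c d N HcN Hd) as [theta [l [Htheta Hsym]]].
  destruct (good_point theta lambda h l Htheta Hl Hh) as [s [Hs0 Hgood]].
  destruct (Hsym s Hs0) as [e [He Hle]].
  assert (Hl2 : 0 < lambda ^ 2) by (apply pow_lt; lra).
  assert (He' : 0 < / lambda ^ 2 * e)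
    by (apply Rmult_lt_0_compat; [now apply Rinv_0_lt_compat|lra]).
  (* Each dilation multiplies the squared modulus by at least [e / lambda ^ 2], since [xi] is good
     at all levels below [n]. *)
  assert (Hlow : forall n, exists xi, a <= Rabs xi /\
    m * (/ lambda ^ 2 * e) ^ n <= fourier_norm2 B f (lambda ^ n * xi)).
  { intros n. destruct (Hgood u n) as [xi [Hxi Hk]].
    destruct (Hint xi Hxi) as [Hxa Hxm]. exists xi. split; [exact Hxa|].
    induction n as [|n IH].
    - simpl. rewrite Rmult_1_l. lra.
    - specialize (IH (fun k b Hkn => Hk k b (Nat.lt_lt_succ_r _ _ Hkn))).
      replace (lambda ^ S n * xi) with (lambda * (lambda ^ n * xi)) by (simpl; ring).
      rewrite (fourier_norm2_dilation lambda N c d f A B) by trivial.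
      specialize (Hle (lambda ^ n * xi) (fun b Hb => Hk n b (Nat.lt_succ_diag_r n) Hb)).
      replace (m * (/ lambda ^ 2 * e) ^ S n)
        with (/ lambda ^ 2 * e * (m * (/ lambda ^ 2 * e) ^ n)) by (simpl; ring).
      apply Rmult_le_compat; [lra| | |exact IH].
      + apply Rmult_le_pos; [lra|apply pow_le; lra].
      + apply Rmult_le_compat_l; [|exact Hle]. now apply Rlt_le, Rinv_0_lt_compat. }
  (* The decay order [k] is chosen so that [lambda ^ (2 * k)] times the ratio [e / lambda ^ 2]
     exceeds 1; then [(lambda ^ n * xi) ^ (2 * k)] times the squared modulus is unbounded in [n]. *)
  destruct (Pow_x_infinity (lambda ^ 2)) with (b := lambda ^ 2 / e + 1) as [k Hk].
  { rewrite Rabs_pos_eq by lra. simpl. nra. }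
  specialize (Hk k (Nat.le_refl k)). rewrite Rabs_pos_eq in Hk by (apply pow_le; lra).
  assert (Hq : 0 < 1 < (lambda ^ 2) ^ k * (/ lambda ^ 2 * e)).
  { split; [lra|]. apply Rlt_le_trans with ((lambda ^ 2 / e + 1) * (/ lambda ^ 2 * e)).
    - replace ((lambda ^ 2 / e + 1) * (/ lambda ^ 2 * e)) with (1 + / lambda ^ 2 * e)
        by (field; lra). lra.
    - apply Rmult_le_compat_r; lra. }
  destruct (fourier_norm2_decay f A B k Hs H0 HAB) as [K HK].
  assert (Hak : 0 < (a ^ k) ^ 2) by (apply pow_lt, pow_lt; exact Ha).
  destruct (powers_not_dominated 1 _ K ((a ^ k) ^ 2 * m) Hq) as [n Hn]; [nra|].
  destruct (Hlow n) as [xi [Hxa Hxi]]. specialize (HK (lambda ^ n * xi)).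
  rewrite pow1, Rmult_1_r in Hn. apply (Rlt_irrefl K).
  eapply Rlt_le_trans; [exact Hn|]. eapply Rle_trans; [|exact HK].
  replace (((lambda ^ n * xi) ^ k) ^ 2) with ((xi ^ k) ^ 2 * ((lambda ^ 2) ^ k) ^ n).
  - rewrite Rpow_mult_distr.
    replace ((a ^ k) ^ 2 * m * (((lambda ^ 2) ^ k) ^ n * (/ lambda ^ 2 * e) ^ n))
      with ((a ^ k) ^ 2 * ((lambda ^ 2) ^ k) ^ n * (m * (/ lambda ^ 2 * e) ^ n)) by ring.
    assert (0 <= ((lambda ^ 2) ^ k) ^ n) by (apply pow_le, pow_le; lra).
    apply Rmult_le_compat; trivial.
    + apply Rmult_le_pos; lra.
    + apply Rmult_le_pos; [lra|apply pow_le; lra].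
    + apply Rmult_le_compat_r; [trivial|].
      rewrite <- (pow2_abs (xi ^ k)), <- RPow_abs. apply pow_incr.
      split; [apply pow_le; lra|]. apply pow_incr. lra.
  - rewrite (Rpow_mult_distr (lambda ^ n)), Rpow_mult_distr, <- !pow_mult, Rmult_comm.
    do 2 f_equal. lia.
Qed.

Theorem theorem1p1 (lambda : R) (N : nat) (c : nat -> R) (d : nat -> Q)
    (hlambda : 1 < lambda)
    (hd : forall j : nat, (j < N)%nat -> (d j < d (S j))%Q)
    (f : R -> R) (hsmooth : smooth f) (hsupp : compactly_supported f)
    (hf : refinement_equation lambda N c d f) :
  forall x : R, f x = 0.
Proof.
  (* Vanishing last coefficients are dropped until the last one is nonzero; if none remains, the
     equation itself reads [f x = 0]. *)
  induction N as [|N IH].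
  - destruct (Req_dec (c 0%nat) 0) as [E|E].
    + intros x. rewrite (hf x). simpl. rewrite E. ring.
    + now apply (refinable_zero lambda 0 c d f).
  - destruct (Req_dec (c (S N)) 0) as [E|E].
    + apply IH.
      * intros j Hj. apply hd. lia.
      * intros x. rewrite (hf x). simpl. rewrite E. ring.
    + now apply (refinable_zero lambda (S N) c d f).
Qed.
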